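(* Let $n\ge 1$ and let $p(z)=\sum_{k=-n}^{n} a_k z^k$ be a Laurent polynomial with complex coefficients such that $a_n a_{-n}\neq 0$. Let $P(z)=p(z)-p(1/\overline{z})$ for $z\in\mathbb{C}\setminus\{0\}$. If the zero set of $P$ is unbounded, then at least one of the following holds: (a) $p(\mathbb{T})$ is contained in a line; (b) there exists $\eta\in\mathbb{T}$ such that $\eta a_n+\overline{\eta a_{-n}}=0$, and furthermore there is an integer $k\in\{1,\dots,n-1\}$ such that the harmonic polynomial $z\mapsto \operatorname{Im}\big((\eta a_k+\overline{\eta a_{-k}})z^k\big)$ is nonconstant and shares a nonzero root with the harmonic polynomial $z\mapsto\operatorname{Re}(\eta a_n z^n)$ (that is, both vanish at some common $z\in\mathbb{C}\setminus\{0\}$). As a partial converse: if (a) holds, then the zero set of $P$ is unbounded.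
   Context: $\mathbb{T}=\{z\in\mathbb{C}:|z|=1\}$ is the unit circle. A line means a real (affine) line in $\mathbb{C}\cong\mathbb{R}^2$. *)

(* Defs.v *)
From mathcomp Require Import all_boot all_order all_algebra.
From mathcomp Require Import all_classical all_reals all_analysis.
From mathcomp Require Import complex.
Set Implicit Arguments.
Unset Strict Implicit.
Unset Printing Implicit Defensive.
Import Order.TTheory GRing.Theory Num.Theory.
Import numFieldNormedType.Exports.
Local Open Scope classical_set_scope.
Local Open Scope ring_scope.

Definition unit_circle (R : realType) : set R[i] := [set z | `|z| = 1].

(* The index [i] runs over [0, 2n], so that the exponent [i - n] runs over
   [-n, n]; values of [a] outside this range are irrelevant. *)
Definition laurent_poly (R : realType) (n : nat) (a : int -> R[i]) (z : R[i]) :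
    R[i] :=
  \sum_(i < (2 * n).+1) a (i%:Z - n%:Z) * z ^ (i%:Z - n%:Z).

Definition reflection_diff (R : realType) (p : R[i] -> R[i]) (z : R[i]) : R[i] :=
  p z - p (1 / z^*).

(* The domain is the punctured plane; [0] is excluded explicitly because
   inversion is total with [0^-1 = 0]. *)
Definition punctured_zero_set (R : realType) (f : R[i] -> R[i]) : set R[i] :=
  [set z | z != 0 /\ f z = 0].

Definition is_real_line (R : realType) (L : set R[i]) : Prop :=
  exists w v : R[i], v != 0 /\ L = range (fun t : R => w + real_complex R t * v).

Definition contained_in_line (R : realType) (A : set R[i]) : Prop :=
  exists L : set R[i], is_real_line L /\ A `<=` L.

Definition nonconstant (T U : Type) (f : T -> U) : Prop :=
  ~ exists c : U, forall x : T, f x = c.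

Definition share_nonzero_root (R : realType) (f g : R[i] -> R) : Prop :=
  exists z : R[i], [/\ z != 0, f z = 0 & g z = 0].

(* Main.v *)
Require Import Defs.
From mathcomp Require Import all_boot all_order all_algebra.
From mathcomp Require Import all_classical all_reals all_analysis.
From mathcomp Require Import complex.
From mathcomp Require Import ring lra zify.
Import Order.TTheory GRing.Theory Num.Theory.
Import numFieldNormedType.Exports.
Local Open Scope classical_set_scope.
Local Open Scope ring_scope.

(** In polar coordinates [z = r u], with [r > 0] and [u] on the unit circle,
the reflected point is [1 / z^* = u / r], so that
[P z = \sum_(1 <= k <= n) s_k q_k] with [s_k = r^k - r^-k] ([radial]) and
[q_k = a_k u^k - a_-k u^-k] ([angular]).  See [reflection_diff_polar].

Suppose the zeros are unbounded.  Since [r s_k <= s_m] for [k < m], a zero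
with [r > 1] makes the top coefficient of the sum of size [O(1 / r)]
([leading_coef_bound]).  Hence [q_n] is arbitrarily small at points of the
circle, which forces [|a_n| = |a_-n|]; so some rotation [eta] gives
[eta a_n + (eta a_-n)^* = 0], and after multiplying the coefficients by [eta]
one has [q_n = 2 Re (a_n u^n)].  Subtracting from [P z] its conjugate kills
this term and leaves the sum of the [s_k 2 i Im (b_k u^k)], where
[b_k = a_k + (a_-k)^*] ([sym_coef]).  If every [b_k] with [1 <= k <= n]
vanishes, then [Re (eta p)] is constant on the circle, which is (a)
([line_of_sym_coef]).  Otherwise let [K] be the largest index with
[b_K != 0]; it is less than [n], and the same estimate applied to the
truncated sum makes [Im (b_K u^K)] small at the same points where
[Re (a_n u^n)] is small ([escaping_small]).  By compactness of the circle both
vanish at a common point ([circle_common_zero]), which is (b).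

Conversely, if [p] maps the circle into a line of direction [v], then
[v^* p] has constant imaginary part on the circle.  Comparing coefficients,
[v^* a_k] and [v^* a_-k] are conjugate for [1 <= k <= n], so that [v^* P] is
[2 i] times the sum of the [s_k Im (v^* a_k u^k)].  On each circle this is a
real trigonometric polynomial in the angle without constant term, that is,
the derivative of a periodic function; by Rolle's theorem it vanishes
somewhere ([trig_poly_zero]).  Thus [P] has a zero of every modulus. *)

(** * The radial factors and the dominance of the top term *)

(** The factor [r^k - r^-k] carried by the terms of degree [k] and [-k]. *)
Definition radial {F : fieldType} (r : F) (k : nat) : F := r ^+ k - r ^- k.

Lemma radial0 (F : fieldType) (r : F) : radial r 0 = 0.
Proof. by rewrite /radial expr0 invr1 subrr. Qed.

Lemma radial_gt0 (F : numFieldType) (r : F) (k : nat) :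
  1 < r -> (0 < k)%N -> 0 < radial r k.
Proof.
move=> r1 k0; have rk1 : 1 < r ^+ k by rewrite exprn_egt1 // -lt0n.
by rewrite subr_gt0 (lt_trans _ rk1) // invf_lt1 // (lt_trans ltr01 rk1).
Qed.

Lemma radial_step (F : numFieldType) (r : F) (k : nat) :
  1 < r -> r * radial r k <= radial r k.+1.
Proof.
move=> r1; have r0 : 0 < r := lt_trans ltr01 r1.
rewrite /radial mulrBr -exprS lerD2l lerN2.
rewrite exprS invfM ler_pM2r ?invr_gt0 ?exprn_gt0 //.
by apply: le_trans (ltW r1); rewrite invf_le1 // ltW.
Qed.

Lemma radial_le (F : numFieldType) (r : F) (k m : nat) :
  1 < r -> (k < m)%N -> r * radial r k <= radial r m.
Proof.
move=> r1; elim: m => // m IH; rewrite ltnS leq_eqVlt => /predU1P[->|km].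
  exact: radial_step.
apply: (le_trans (IH km)); apply: le_trans (radial_step F r m r1).
by rewrite ler_peMl ?ltW // radial_gt0 // (leq_ltn_trans _ km).
Qed.

Lemma radial_ge0 (F : numFieldType) (r : F) (k : nat) :
  1 < r -> 0 <= radial r k.
Proof. by case: k => [|k] r1; rewrite ?radial0// ltW// radial_gt0. Qed.

(** When a combination of the radial factors vanishes, its top coefficient is
[O(1 / r)]; the hypothesis [0 < m] is needed since [radial r 0 = 0]. *)
Lemma leading_coef_bound (F : numFieldType) (r M : F) (m : nat)
    (q : nat -> F) :
  1 < r -> (0 < m)%N -> (forall k, (k < m)%N -> `|q k| <= M) ->
  \sum_(k < m.+1) radial r k * q k = 0 -> `|q m| * r <= m%:R * M.
Proof.
move=> r1 m0 qM; have s0 := radial_gt0 F r m r1 m0.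
have r0 : 0 < r := lt_trans ltr01 r1.
rewrite big_ord_recr /= => /eqP; rewrite addr_eq0 => /eqP/(congr1 Num.norm).
rewrite normrN normrM (gtr0_norm s0) => E.
rewrite -(ler_pM2l s0) mulrA -E.
apply: le_trans (_ : (\sum_(k < m) `|radial r k * q k|) * r <= _).
  by rewrite ler_pM2r // ler_norm_sum.
rewrite mulr_suml mulrCA mulr_natl -[X in _ *+ X](card_ord m) -sumr_const.
apply: ler_sum => k _; rewrite normrM (ger0_norm (radial_ge0 _ _ k r1)).
rewrite mulrAC [_ * r]mulrC ler_pM ?qM ?normr_ge0//.
  by rewrite mulr_ge0 ?radial_ge0 // ltW.
exact: radial_le.
Qed.

(** * Polar form of the reflected difference *)

Section Polar.
Variable R : realType.
Local Notation C := R[i].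
Implicit Types (a : int -> C) (n k : nat) (z u r : C).

Lemma laurent_polyE n a z :
  laurent_poly n a z
  = a 0 + \sum_(k < n) (a k.+1%:Z * z ^+ k.+1 + a (- k.+1%:Z) * z ^- k.+1).
Proof.
rewrite /laurent_poly; elim: n => [|n IH].
  by rewrite big_ord_recl !big_ord0 /= subrr expr0z mulr1.
have -> : ((2 * n.+1).+1 = ((2 * n).+1).+2)%N by lia.
rewrite big_ord_recl big_ord_recr /= [in RHS]big_ord_recr /= [RHS]addrA -IH.
rewrite [LHS]addrC -!addrA; congr (_ + _).
  apply: eq_bigr => i _; rewrite /bump /=.
  by have -> : ((1 + i)%N%:Z - n.+1%:Z = i%:Z - n%:Z)%R by lia.
congr (_ + _).
  rewrite /bump /=.
  by have -> : ((1 + (2 * n).+1)%N%:Z - n.+1%:Z = n.+1%:Z)%R by lia.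
by rewrite sub0r -exprnN.
Qed.

(** The angular factor [a_k u^k - a_-k u^-k], for [u] on the unit circle,
where [u^-k] is written as the conjugate of [u^k]. *)
Definition angular a k u : C := a k%:Z * u ^+ k - a (- k%:Z) * (u ^+ k)^*.

Lemma reflection_diff_polar n a r u : 0 < r -> `|u| = 1 ->
  reflection_diff (laurent_poly n a) (r * u)
  = \sum_(k < n.+1) radial r k * angular a k u.
Proof.
move=> r0 u1; have rr : r^* = r by apply/CrealP; rewrite ger0_real // ltW.
have uc : u^-1 = u^* by rewrite invC_norm u1 expr1n invr1 mul1r.
rewrite /reflection_diff !laurent_polyE.
rewrite opprD addrACA subrr add0r -sumrB [RHS]big_ord_recl radial0 mul0r add0r.
apply: eq_bigr => k _; rewrite /radial /angular lift0.
have -> : 1 / (r * u)^* = r^-1 * u.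
  by rewrite div1r rmorphM /= rr invfM -uc invrK.
by rewrite rmorphXn /= -uc !exprMn !invfM -!exprVn invrK; ring.
Qed.
End Polar.

(** * Consequences of an unbounded zero set *)

Section Forward.
Variable R : realType.
Local Notation C := R[i].
Implicit Types (a : int -> C) (n k : nat) (z u r : C).

(** Bounds are complex numbers here, since the norm of [R[i]] is complex
valued; only the real ones matter. *)
Lemma unbounded_setP (A : set C) :
  ~ bounded_set (A : set R[i]^o) <->
  forall M : C, M \is Num.real -> exists2 z, A z & M < `|z|.
Proof.
split=> [unb M Mr|esc [M [Mr bnd]]].
  apply/not_exists2P => bnd; apply: unb; exists M; split=> // N MN z Az.
  have [//|] := bnd z => /negP; rewrite -real_leNgt ?normr_real// => zM.
  exact: le_trans zM (ltW MN).
have [z Az zM] := esc (M + 1) (realD Mr (real1 _)).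
have := bnd (M + 1); rewrite ltrDl ltr01 => /(_ isT z Az) /=.
by move=> /(lt_le_trans zM); rewrite ltxx.
Qed.

(** [P] has zeros [r u] of arbitrarily large modulus [r], in polar form. *)
Definition escaping n a : Prop :=
  forall M : C, M \is Num.real -> exists r u,
    [/\ M < r, 1 < r, `|u| = 1 &
        \sum_(k < n.+1) radial r k * angular R a k u = 0].

Lemma escapingP n a :
  ~ bounded_set (punctured_zero_set (reflection_diff (laurent_poly n a))
     : set R[i]^o) -> escaping n a.
Proof.
move=> /unbounded_setP esc M Mr.
have mr : Num.max M 1 \is Num.real by rewrite max_real ?real1.
have [z [z0 Pz]] := esc _ mr.
rewrite comparable_gt_max ?real_comparable ?real1// => /andP[Mz z1].
have u1 : `|z / `|z| | = 1 by rewrite normrM normfV normr_id divff ?normr_eq0.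
have zE : `|z| * (z / `|z|) = z by rewrite mulrC divfK ?normr_eq0.
exists `|z|, (z / `|z|); split=> //.
have z_gt0 : 0 < `|z| by rewrite normr_gt0.
by have := reflection_diff_polar R n a _ _ z_gt0 u1; rewrite zE Pz.
Qed.

(** A bound for all the angular factors with index at most [n]. *)
Definition coef_bound n a : C := \sum_(k < n.+1) (`|a k%:Z| + `|a (- k%:Z)|).

Lemma coef_bound_real n a : coef_bound n a \is Num.real.
Proof. by rewrite ger0_real// sumr_ge0// => k _; rewrite addr_ge0. Qed.

Lemma angular_le n a k u : `|u| = 1 -> (k <= n)%N ->
  `|angular R a k u| <= coef_bound n a.
Proof.
move=> u1 kn; apply: le_trans (ler_normB _ _) _.
rewrite !normrM norm_conjC normrX u1 expr1n !mulr1.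
rewrite /coef_bound (bigD1 (Ordinal (kn : (k < n.+1)%N)))//= lerDl.
by rewrite sumr_ge0// => i _; rewrite addr_ge0.
Qed.

(** At a zero of modulus [r] the distance between the two moduli is at most
[|angular a n u|], hence [O(1 / r)]. *)
Lemma escaping_norm_eq n a : (0 < n)%N -> escaping n a ->
  `|a n%:Z| = `|a (- n%:Z)|.
Proof.
move=> n0 esc; apply/eqP; rewrite -subr_eq0 -normr_eq0; apply/negP => /negP d0.
set d := `|_| in d0; have dp : 0 < d by rewrite lt_def d0 normr_ge0.
have Mr : n%:R * coef_bound n a / d \is Num.real.
  by rewrite realM ?realV ?realM ?coef_bound_real ?realn// gtr0_real.
have [r [u [Mr' r1 u1 S0]]] := esc _ Mr.
have := leading_coef_bound _ r _ n _ r1 n0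
  (fun k kn => angular_le n a k u u1 (ltnW kn)) S0.
apply/negP; rewrite -real_ltNge; first last.
- by rewrite realM// ?ger0_real// ltW// (lt_trans ltr01).
- by rewrite realM ?coef_bound_real ?realn.
move: Mr'; rewrite ltr_pdivrMr// => /lt_le_trans; apply.
rewrite mulrC ler_pM2r ?(lt_trans ltr01)//.
have un : `|u ^+ n| = 1 by rewrite normrX u1 expr1n.
have -> : d = `| `|a n%:Z * u ^+ n| - `|a (- n%:Z) * (u ^+ n)^*| |.
  by rewrite !normrM norm_conjC un !mulr1.
exact: ler_dist_dist.
Qed.

(** The rotation is a square root of [- y^* / x]. *)
Lemma unit_rotation (x y : C) : x != 0 -> `|x| = `|y| ->
  exists2 eta : C, `|eta| = 1 & eta * x + (eta * y)^* = 0.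
Proof.
move=> x0 xy; pose eta := sqrtC (- y^* / x).
have e2 : eta ^+ 2 * x = - y^* by rewrite sqrtCK divfK.
have e1 : `|eta| = 1.
  apply/eqP; rewrite -(@pexpr_eq1 _ _ 2)// -normrX; apply/eqP.
  apply: (mulIf (_ : `|x| != 0)); first by rewrite normr_eq0.
  by rewrite -normrM e2 normrN norm_conjC mul1r.
exists eta => //; apply/eqP; rewrite addr_eq0 rmorphM/= -mulrN -e2.
by rewrite mulrA expr2 mulrA [_^* * _]mulrC -normCK e1 expr1n mul1r.
Qed.

(** [a_k + (a_-k)^*]; it vanishes exactly when the terms of degree [k] and
[-k] of the Laurent polynomial add up to a purely imaginary number at every
point of the circle. *)
Definition sym_coef a k : C := a k%:Z + (a (- k%:Z))^*.

Lemma angular_antisym a k u :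
  angular R a k u - (angular R a k u)^*
  = sym_coef a k * u ^+ k - (sym_coef a k * u ^+ k)^*.
Proof.
by rewrite /angular /sym_coef !(rmorphB, rmorphM, rmorphD)/= !conjCK; ring.
Qed.

Lemma angular_sym a k u : sym_coef a k = 0 ->
  angular R a k u = a k%:Z * u ^+ k + (a k%:Z * u ^+ k)^*.
Proof.
rewrite /sym_coef => /eqP; rewrite addrC addr_eq0 => /eqP E.
rewrite /angular rmorphM/= -[a (- _)]conjCK E rmorphN/=.
by rewrite mulNr opprK.
Qed.

(** At far zeros, the real part of [a_n u^n] and the imaginary part of
[sym_coef a K * u^K] are simultaneously small; the differences and sums with
the conjugate are [2 'i] times, respectively twice, these parts. *)
Lemma escaping_small n a K (e : C) : escaping n a -> (0 < K <= n)%N ->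
  sym_coef a n = 0 -> (forall k, (K < k <= n)%N -> sym_coef a k = 0) ->
  0 < e ->
  exists u, [/\ `|u| = 1,
    `|a n%:Z * u ^+ n + (a n%:Z * u ^+ n)^*| < e &
    `|sym_coef a K * u ^+ K - (sym_coef a K * u ^+ K)^*| < e].
Proof.
move=> esc /andP[K0 Kn] sn0 sK0 e0.
have n0 : (0 < n)%N := leq_trans K0 Kn.
have Mr : n%:R * (2%:R * coef_bound n a) / e \is Num.real.
  by rewrite realM ?realV ?realM ?realM ?coef_bound_real ?realn// gtr0_real.
have [r [u [re r1 u1 S0]]] := esc _ Mr.
have r0 : 0 < r := lt_trans ltr01 r1.
have b0 : 0 <= coef_bound n a.
  exact: le_trans (normr_ge0 _) (angular_le n a 0 u u1 (leq0n n)).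
have small (x : C) (m : nat) : (m <= n)%N ->
    `|x| * r <= m%:R * (2%:R * coef_bound n a) -> `|x| < e.
  move=> mn xr; rewrite -(ltr_pM2r r0); apply: le_lt_trans xr _.
  move: re; rewrite ltr_pdivrMr// [r * e]mulrC; apply: le_lt_trans.
  by rewrite ler_wpM2r ?mulr_ge0 ?ler0n// ler_nat.
exists u; split=> //.
  rewrite -angular_sym//. apply: (small (angular R a n u) n (leqnn n)).
  have := leading_coef_bound _ r _ n _ r1 n0
    (fun k kn => angular_le n a k u u1 (ltnW kn)) S0.
  move=> /le_trans; apply; rewrite ler_wpM2l ?ler0n//.
  by rewrite mulr_natl mulr2n lerDl.
(* The terms above [K] cancel in the difference with the conjugate. *)
rewrite -angular_antisym; apply: (small _ K) => //.
apply: (leading_coef_bound _ r _ K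
  (fun k => angular R a k u - (angular R a k u)^*)) => // [k kK|].
  apply: le_trans (ler_normB _ _) _; rewrite norm_conjC mulr_natl mulr2n.
  by have kn := ltnW (leq_trans kK Kn); rewrite lerD ?angular_le.
have rr k : (radial r k)^* = radial r k.
  by apply/CrealP; rewrite ger0_real// radial_ge0.
have T0 : \sum_(k < n.+1)
    radial r k * (angular R a k u - (angular R a k u)^*) = 0.
  transitivity (\sum_(k < n.+1) radial r k * angular R a k u
    - (\sum_(k < n.+1) radial r k * angular R a k u)^*).
    rewrite rmorph_sum -sumrB; apply: eq_bigr => k _.
    by rewrite rmorphM/= rr mulrBr.
  by rewrite S0 rmorph0 subr0.
rewrite -[RHS]T0 (big_ord_widen n.+1
  (fun k => radial r k * (angular R a k u - (angular R a k u)^*)))//.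
rewrite [RHS](bigID (fun k : 'I_n.+1 => (k < K.+1)%N))/=.
rewrite [X in _ = _ + X]big1 ?addr0// => k; rewrite -leqNgt => Kk.
rewrite angular_antisym sK0 ?mul0r ?rmorph0 ?subrr ?mulr0//.
by rewrite Kk -ltnS ltn_ord.
Qed.
End Forward.

(** * Real trigonometric functions on the circle *)

Section Circle.
Variable R : realType.
Local Notation C := R[i].

(** The point of argument [t] on the unit circle. *)
Definition cis (t : R) : C := Complex (cos t) (sin t).

Lemma normC_Re_Im (z : C) : `|z| = 1 <-> complex.Re z ^+ 2 + complex.Im z ^+ 2 = 1.
Proof.
split=> [z1|E]; last by rewrite normc_def E sqrtr1.
by apply: (@complexI R); rewrite add_Re2_Im2 z1 expr1n.
Qed.

Lemma norm_cis t : `|cis t| = 1.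
Proof. by apply/normC_Re_Im; rewrite /= cos2Dsin2. Qed.

Lemma cisX t k : cis t ^+ k = cis (k%:R * t).
Proof.
elim: k => [|k IH]; first by rewrite expr0 mul0r /cis cos0 sin0.
rewrite exprS IH -natr1 mulrDl mul1r addrC /cis cosD sinD.
by apply/eqP; rewrite eq_complex /= eqxx /= addrC.
Qed.

Lemma cis_surj (u : C) : `|u| = 1 ->
  exists2 t : R, t \in `[(- pi), pi] & u = cis t.
Proof.
case: u => x y /normC_Re_Im /= E.
have xI : -1 <= x <= 1 by apply/andP; split; nra.
have xI' : x \in `[-1, 1] by rewrite in_itv.
have [p0 pp] := (acos_ge0 xI, acos_lepi xI).
have sE : Num.sqrt (1 - x ^+ 2) = `|y| by rewrite -E addrAC subrr add0r sqrtr_sqr.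
have [y0|y0] := leP 0 y.
  exists (acos x); first by rewrite in_itv/= pp andbT (le_trans _ p0)// oppr_le0 pi_ge0.
  by rewrite /cis acosK// sin_acos// sE ger0_norm.
exists (- acos x).
  by rewrite in_itv/= lerN2 pp/= (le_trans _ (pi_ge0 R))// oppr_le0.
by rewrite /cis cosN sinN acosK// sin_acos// sE ltr0_norm ?opprK.
Qed.

Lemma Re_mul_cis (c : C) (t : R) :
  complex.Re (c * cis t) = complex.Re c * cos t - complex.Im c * sin t.
Proof. by case: c. Qed.

Lemma Im_mul_cis (c : C) (t : R) :
  complex.Im (c * cis t) = complex.Re c * sin t + complex.Im c * cos t.
Proof. by case: c. Qed.

Lemma continuous_Re_mul_cis (c : C) (w : R) :
  continuous (fun t : R => complex.Re (c * cis (w * t)) : R).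
Proof.
move=> t; under eq_fun do rewrite Re_mul_cis.
by apply: cvgB; apply: cvgM; [exact: cvg_cst| |exact: cvg_cst|];
  apply: continuous_comp; [exact: mulrl_continuous|exact: continuous_cos
                          |exact: mulrl_continuous|exact: continuous_sin].
Qed.

Lemma continuous_Im_mul_cis (c : C) (w : R) :
  continuous (fun t : R => complex.Im (c * cis (w * t)) : R).
Proof.
move=> t; under eq_fun do rewrite Im_mul_cis.
by apply: cvgD; apply: cvgM; [exact: cvg_cst| |exact: cvg_cst|];
  apply: continuous_comp; [exact: mulrl_continuous|exact: continuous_sin
                          |exact: mulrl_continuous|exact: continuous_cos].
Qed.

(** Compactness of the circle: the sum of the two absolute values attains its
minimum. *)
Lemma circle_common_zero (A B : C) (n k : nat) :
  (forall e : R, 0 < e -> exists u : C, [/\ `|u| = 1,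
     `|complex.Re (A * u ^+ n)| < e & `|complex.Im (B * u ^+ k)| < e]) ->
  exists u : C, [/\ `|u| = 1, complex.Re (A * u ^+ n) = 0 &
                    complex.Im (B * u ^+ k) = 0].
Proof.
move=> small.
pose g (t : R) : R := `|complex.Re (A * cis (n%:R * t))|
                      + `|complex.Im (B * cis (k%:R * t))|.
have cg : continuous g.
  move=> t; apply: cvgD; apply: cvg_norm.
    exact: continuous_Re_mul_cis.
  exact: continuous_Im_mul_cis.
have pp : - pi <= pi :> R by rewrite (le_trans _ (pi_ge0 R))// oppr_le0 pi_ge0.
have [t tI tmin] := EVT_min pp (continuous_subspaceT cg).
have g0 : g t <= 0.
  rewrite leNgt; apply/negP => gt0.
  have [|u [u1 uA uB]] := small (g t / 2); first by rewrite divr_gt0.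
  have [s sI us] := cis_surj u u1.
  have := tmin s sI; apply/negP; rewrite -ltNge.
  move: uA uB; rewrite us !cisX => uA uB.
  by rewrite [X in _ < X](splitr (g t)) ltrD.
exists (cis t); rewrite norm_cis !cisX; split=> //; apply/eqP.
  by rewrite -normr_le0 (le_trans _ g0)// lerDl.
by rewrite -normr_le0 (le_trans _ g0)// lerDr.
Qed.

(** A real trigonometric polynomial without constant term has a zero, by
Rolle's theorem applied to its periodic antiderivative [G]. *)
Lemma trig_poly_zero (n : nat) (c : nat -> C) (d : nat -> R) :
  exists2 u : C, `|u| = 1 &
    \sum_(k < n) d k * complex.Im (c k * u ^+ k.+1) = 0.
Proof.
pose G (t : R) : R :=
  \sum_(k < n) d k / k.+1%:R * complex.Re (c k * cis (k.+1%:R * t)).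
have dG t : is_derive (t : R) (1 : R) (G : R -> R)
    (- \sum_(k < n) d k * complex.Im (c k * cis (k.+1%:R * t))).
  have -> : G = \sum_(k < n) (fun t =>
      d k / k.+1%:R * complex.Re (c k * cis (k.+1%:R * t))).
    by apply/funext => s; rewrite /G fct_sumE.
  rewrite -sumrN; apply: is_derive_sum => k.
  under eq_fun do rewrite Re_mul_cis.
  rewrite Im_mul_cis.
  apply: is_derive_eq.
  rewrite /GRing.scale/=.
  have k0 : k.+1%:R != 0 :> R by rewrite pnatr_eq0.
  by field.
have [t _ dGt] : exists2 t, t \in `]0, pi *+ 2[ & is_derive (t : R) (1 : R) (G : R -> R) 0.
  apply: Rolle; first by rewrite pmulrn_rgt0 ?pi_gt0.
  - by move=> t _; exact: ex_derive.
  - apply: continuous_subspaceT => t; apply: differentiable_continuous.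
    by apply/derivable1_diffP; exact: ex_derive.
  - apply: eq_bigr => k _; rewrite -!cisX; congr (_ * complex.Re (_ * _ ^+ _)).
    by rewrite /cis cos0 sin0 cos2pi sin2pi.
exists (cis t); first exact: norm_cis.
have /(congr1 -%R) := @derive_val _ _ _ _ _ _ _ (dG t).
rewrite (@derive_val _ _ _ _ _ _ _ dGt) oppr0 opprK => E.
by rewrite [RHS]E; apply: eq_bigr => k _; rewrite cisX.
Qed.

Lemma normC_real (x : R) : `|real_complex R x| = real_complex R `|x|.
Proof. by rewrite normc_def /= expr0n addr0 sqrtr_sqr. Qed.

Lemma norm_Re_lt (x : C) (e : R) :
  `|x + x^*| < real_complex R e -> `|complex.Re x| < e.
Proof.
move=> xe; rewrite -ltcR -normC_real complexRe ReE; apply: le_lt_trans xe.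
by rewrite normrM ler_piMr// normfV normr_nat invf_le1 ?ler1n ?ltr0n.
Qed.

Lemma norm_Im_lt (x : C) (e : R) :
  `|x - x^*| < real_complex R e -> `|complex.Im x| < e.
Proof.
move=> xe; rewrite -ltcR -normC_real complexIm ImE; apply: le_lt_trans xe.
rewrite !normrM normCi mul1r distrC ler_piMr//.
by rewrite normfV normr_nat invf_le1 ?ler1n ?ltr0n.
Qed.
End Circle.

(** * Images of the circle contained in a line *)

Section Lines.
Variable R : realType.
Local Notation C := R[i].
Implicit Types (a : int -> C) (n k : nat) (z u v w : C).

Lemma laurent_poly_circle n a u : `|u| = 1 ->
  laurent_poly n a u
  = a 0 + \sum_(k < n) (a k.+1%:Z * u ^+ k.+1 + a (- k.+1%:Z) * (u ^+ k.+1)^*).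
Proof.
move=> u1; rewrite laurent_polyE; congr (_ + _); apply: eq_bigr => k _.
by congr (_ + _ * _); rewrite invC_norm normrX u1 !expr1n invr1 mul1r.
Qed.

(** A Laurent polynomial that is constant on the circle has no term of
positive degree: multiplied by [u^n], its difference with the constant is a
polynomial with infinitely many roots. *)
Lemma laurent_poly_circle_const n a (c : C) :
  (forall u, `|u| = 1 -> laurent_poly n a u = c) ->
  forall k, (0 < k <= n)%N -> a k%:Z = 0.
Proof.
move=> pc k /andP[k0 kn].
pose q : {poly C} := \poly_(i < (2 * n).+1) a (i%:Z - n%:Z) - c *: 'X^n.
suff q0 : q = 0.
  have := congr1 (fun q : {poly C} => q`_(n + k)) q0.
  rewrite coefB coef_poly coefZ coefXn coef0 gtn_eqF ?mulr0 ?subr0; last by lia.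
  have -> : (n + k < (2 * n).+1)%N by lia.
  by have -> : (n + k)%N%:Z - n%:Z = k%:Z :> int by lia.
have rootq u : `|u| = 1 -> root q u.
  move=> u1; have u0 : u != 0 by rewrite -normr_eq0 u1 oner_neq0.
  rewrite /root hornerD hornerN hornerZ hornerXn horner_poly subr_eq0.
  rewrite -(pc u u1) mulr_suml; apply/eqP/eq_bigr => i _.
  rewrite -mulrA; congr (_ * _).
  by rewrite -[u ^+ n]/(u ^ n%:Z) -expfzDr// subrK.
apply/eqP/negPn/negP => qn0.
(* Infinitely many points of the circle, told apart by their real parts. *)
pose x (m : nat) : R := m.+1%:R^-1.
pose pt (m : nat) : C := Complex (x m) (Num.sqrt (1 - x m ^+ 2)).
have pt1 m : `|pt m| = 1.
  apply/normC_Re_Im; rewrite /= sqr_sqrtr ?subrKC//.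
  by rewrite subr_ge0 expr_le1 ?invr_ge0 ?ler0n// invf_le1 ?ltr0n// ler1n.
have ptI : injective pt.
  by move=> m m' [/invr_inj/eqP]; rewrite eqr_nat eqSS => /eqP.
suff: false by [].
have := max_poly_roots (rs := [seq pt m | m <- iota 0 (size q)]) qn0.
rewrite size_map size_iota ltnn => F; apply: F.
  by apply/allP => _ /mapP[m _ ->]; exact/rootq/pt1.
by rewrite map_inj_uniq ?iota_uniq.
Qed.

(** [v] is the direction of the line: [v^* p - v p^*] is constant on the
circle, and is itself a Laurent polynomial there. *)
Lemma contained_in_line_coef n a :
  contained_in_line (laurent_poly n a @` @unit_circle R) ->
  exists2 v, v != 0 & forall k, (0 < k <= n)%N ->
    v^* * a k%:Z = v * (a (- k%:Z))^*.
Proof.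
move=> [_ [[w [v [v0 ->]]] sub]]; exists v => // k kn.
apply/eqP; rewrite -subr_eq0; apply/eqP.
apply: (laurent_poly_circle_const n
  (fun j => v^* * a j - v * (a (- j))^*) (v^* * w - v * w^*)) kn.
move=> u u1.
have [t _ E] : range (fun t : R => w + real_complex R t * v) (laurent_poly n a u).
  by apply: sub; exists u.
have tr : (real_complex R t)^* = real_complex R t.
  by apply/CrealP; apply/complex_realP; exists t.
transitivity (v^* * laurent_poly n a u - v * (laurent_poly n a u)^*); last first.
  by rewrite -E !(rmorphD, rmorphM)/= tr; ring.
rewrite !laurent_poly_circle// oppr0 rmorphD rmorph_sum/= !mulrDr !mulr_sumr.
rewrite opprD addrACA -sumrB; congr (_ + _); apply: eq_bigr => i _.
by rewrite opprK !(rmorphD, rmorphM)/= !conjCK; ring.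
Qed.

(** Under the relations between coefficients that hold on a line, every
circle centered at the origin contains a zero. *)
Lemma antisym_circle_zero n a v (r : R) : v != 0 ->
  (forall k, (0 < k <= n)%N -> v^* * a k%:Z = v * (a (- k%:Z))^*) ->
  exists2 u, `|u| = 1 &
    \sum_(k < n.+1) radial (real_complex R r) k * angular R a k u = 0.
Proof.
move=> v0 va.
have [u u1 u0] := trig_poly_zero R n (fun k => v^* * a k.+1%:Z)
  (fun k => radial r k.+1).
exists u => //; apply: (mulfI (_ : v^* != 0)); first by rewrite conjC_eq0.
rewrite mulr0 big_ord_recl radial0 mul0r add0r mulr_sumr.
under eq_bigr do rewrite lift0.
transitivity (real_complex R (\sum_(k < n) radial r k.+1 *
  complex.Im (v^* * a k.+1%:Z * u ^+ k.+1)) * (2%:R * 'i)); last first.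
  by rewrite u0 rmorph0 mul0r.
rewrite rmorph_sum/= mulr_suml; apply: eq_bigr => k _.
rewrite rmorphM/= complexIm ImE /radial rmorphB fmorphV !rmorphXn/=.
have aN : v^* * a (- k.+1%:Z) = v * (a k.+1%:Z)^*.
  have := congr1 Num.conj (va k.+1 (ltn_ord k)).
  by rewrite !rmorphM/= !conjCK => ->.
rewrite /angular !rmorphM/= conjCK.
set s := _ - _; set U := u ^+ _; set U' := U^*; set A := (a k.+1%:Z)^* in aN *.
transitivity (s * (v^* * a k.+1%:Z * U - v^* * a (- k.+1%:Z) * U')).
  by ring.
have two0 : 2%:R != 0 :> C by rewrite pnatr_eq0.
rewrite aN.
transitivity (- ('i ^+ 2) * (s * (v^* * a k.+1%:Z * U - v * A * U'))).
  by rewrite sqrCi opprK mul1r.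
by field.
Qed.

Lemma unbounded_of_line n a :
  contained_in_line (laurent_poly n a @` @unit_circle R) ->
  ~ bounded_set (punctured_zero_set (reflection_diff (laurent_poly n a))
     : set R[i]^o).
Proof.
move=> /contained_in_line_coef[v v0 va].
apply/unbounded_setP => M /complex_realP[m ->].
pose r : R := Num.max m 0 + 1.
have r0 : 0 < r by rewrite ltr_wpDl// le_max lexx orbT.
have [u u1 S0] := antisym_circle_zero n a v r v0 va.
have rC0 : 0 < real_complex R r :> C by rewrite ltcR.
exists (real_complex R r * u).
  split; last by rewrite reflection_diff_polar.
  apply: mulf_neq0; first by rewrite gt_eqF.
  by rewrite -normr_eq0 u1 oner_neq0.
rewrite normrM u1 mulr1 gtr0_norm// ltcR.
by rewrite (@le_lt_trans _ _ (Num.max m 0))// ?le_max ?lexx// ltrDl.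
Qed.

Lemma line_of_sym_coef n a (eta : C) : `|eta| = 1 ->
  (forall k, (0 < k <= n)%N -> sym_coef R (fun j => eta * a j) k = 0) ->
  contained_in_line (laurent_poly n a @` @unit_circle R).
Proof.
move=> e1 s0; have e0 : eta != 0 by rewrite -normr_eq0 e1 oner_neq0.
exists (range (fun t : R => a 0 + real_complex R t * ('i / eta))); split.
  by exists (a 0), ('i / eta); split=> //; rewrite mulf_neq0 ?invr_eq0 ?neq0Ci.
move=> _ [u u1 <-]; pose x := laurent_poly n a u - a 0.
have xJ : (eta * x)^* = - (eta * x).
  rewrite /x laurent_poly_circle// addrC addKr mulr_sumr rmorph_sum -sumrN.
  apply: eq_bigr => k _; have /eqP := s0 k.+1 (ltn_ord k).
  rewrite /sym_coef addrC addr_eq0 => /eqP E.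
  rewrite mulrDr !mulrA rmorphD !(rmorphM _ (_ * _))/= E conjCK.
  rewrite -[eta * a (- _)]conjCK E rmorphN/= -[RHS]opprK.
  by ring.
(* [eta * x] is purely imaginary, so [x = Im (eta * x) * ('i / eta)]. *)
exists (complex.Im (eta * x)) => //.
rewrite complexIm ImE xJ.
have two0 : 2%:R != 0 :> C by rewrite pnatr_eq0.
have -> : 'i * (- (eta * x) - eta * x) / 2%:R * ('i / eta) = - ('i ^+ 2) * x.
  by field.
by rewrite sqrCi opprK mul1r /x addrC subrK.
Qed.

Lemma Im_monomial_nonconstant (B : C) k : B != 0 -> (0 < k)%N ->
  nonconstant (fun z : C => complex.Im (B * z ^+ k)).
Proof.
move=> B0 k0 [c hc].
have c0 : c = 0 by rewrite -(hc 0) expr0n gtn_eqF// mulr0.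
(* At a [k]-th root of ['i / B] the value is [1]; at [0] it is [0]. *)
have := hc (k.-root ('i / B)); rewrite rootCK// mulrC divfK// c0.
by rewrite -complexiE => /eqP; rewrite /= oner_eq0.
Qed.
End Lines.

Theorem theorem4p3 (R : realType) (n : nat) (a : int -> R[i])
    (hn : (1 <= n)%N) (ha : a n%:Z * a (- n%:Z) != 0) :
  let p := laurent_poly n a in
  let P := reflection_diff p in
  (~ bounded_set (punctured_zero_set P : set R[i]^o) ->
     contained_in_line (p @` @unit_circle R) \/
     (exists eta : R[i],
        [/\ @unit_circle R eta,
            eta * a n%:Z + (eta * a (- n%:Z))^* = 0 &
            exists k : nat,
              let h := fun z : R[i] =>
                complex.Im ((eta * a k%:Z + (eta * a (- k%:Z))^*) * z ^+ k) in
              [/\ (1 <= k <= n - 1)%N,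
                  nonconstant h &
                  share_nonzero_root h
                    (fun z : R[i] => complex.Re (eta * a n%:Z * z ^+ n))]])) /\
  (contained_in_line (p @` @unit_circle R) ->
     ~ bounded_set (punctured_zero_set P : set R[i]^o)).
Proof.
move=> p P; split; last exact: unbounded_of_line.
move=> unb; have esc := escapingP R n a unb.
have an0 : a n%:Z != 0 by apply: contraNneq ha => ->; rewrite mul0r.
have [eta e1 en] := unit_rotation R _ _ an0 (escaping_norm_eq R n a hn esc).
pose b j := eta * a j.
have escb : escaping R n b.
  move=> M Mr; have [r [u [Mr' r1 u1 S0]]] := esc M Mr.
  exists r, u; split=> //; rewrite -[RHS](mulr0 eta) -[X in _ = _ * X]S0 mulr_sumr.
  by apply: eq_bigr => k _; rewrite /angular /b; ring.
(* The choice of [eta] is the vanishing of the symmetrized top coefficient,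
   so an index with nonzero [sym_coef] is less than [n]. *)
have bn0 : sym_coef R b n = 0 by [].
pose bad k := (0 < k <= n)%N && (sym_coef R b k != 0).
have [[k0 bad0]|nobad] := pselect (exists k, bad k); last first.
  left; apply: (line_of_sym_coef R n a eta e1) => k kn.
  by apply/eqP/negPn/negP => bk; apply: nobad; exists k; rewrite /bad kn.
right; exists eta; split=> //.
have badn k : bad k -> (k <= n)%N by case/andP => /andP[].
have [K /andP[/andP[K0 Kn] bK0] Kmax] := ex_maxnP (ex_intro bad k0 bad0) badn.
have above k : (K < k <= n)%N -> sym_coef R b k = 0.
  move=> /andP[Kk kn]; apply/eqP/negPn/negP => bk.
  by have := Kmax k; rewrite /bad (leq_trans _ Kk)// kn bk leqNgt Kk => /(_ isT).
exists K; split.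
- rewrite K0/= subn1 -ltnS prednK// ltn_neqAle Kn andbT.
  by apply: contraNneq bK0 => ->; apply/eqP.
- exact: Im_monomial_nonconstant.
have [e epos|u [u1 uA uB]] :=
    circle_common_zero R (b n%:Z) (sym_coef R b K) n K; last first.
  by exists u; split=> //; rewrite -normr_eq0 u1 oner_neq0.
have eC : 0 < real_complex R e :> R[i] by rewrite ltcR.
have KI : (0 < K <= n)%N by rewrite K0.
have [u [u1 uA uB]] := escaping_small R n b K _ escb KI bn0 above eC.
exists u; split=> //; first exact: norm_Re_lt.
exact: norm_Im_lt.
Qed.
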